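(* Let $n\ge 1$, let $C\subseteq\mathbb{Z}_4^n$ be a linear code over $\mathbb{Z}_4$, and let $C'\subseteq\mathbb{Z}_2^{2n}$ be its Gray map image. If $\mathrm{Str}(C)=t$, then $t\le \mathrm{Str}(C')\le 2t+1$.
   Context: $\mathbb{Z}_m$ denotes the ring of integers modulo $m$. A linear code $C$ of length $n$ over $\mathbb{Z}_4$ is a $\mathbb{Z}_4$-submodule of $\mathbb{Z}_4^n$. The Gray map takes $\mathbb{Z}_4$ to $\mathbb{Z}_2^2$ by $0\mapsto 00$, $1\mapsto 01$, $2\mapsto 11$, $3\mapsto 10$, and is extended coordinatewise to a map $\mathbb{Z}_4^n\to\mathbb{Z}_2^{2n}$. The Gray map image $C'$ of $C$ is the set of images of the codewords of $C$ under this map; it is in general a non-linear binary code. An $N\times k$ array with entries from a finite alphabet $F$ is an orthogonal array of strength $t$ and index $\lambda$ (where $0\le t\le k$) if every $N\times t$ subarray (obtained by choosing $t$ distinct columns) contains each $t$-tuple over $F$ exactly $\lambda$ times as a row. A code $D\subseteq F^k$ (linear or not) is an orthogonal array of strength $t$ if the array whose rows are the codewords of $D$, each listed once, is an orthogonal array of strength $t$ for some index $\lambda$. $\mathrm{Str}(D)$ denotes the strength of $D$, i.e. the largest $t$ with $0\le t\le k$ such that $D$ is an orthogonal array of strength $t$. For $C$ the alphabet is $F=\mathbb{Z}_4$ and $k=n$; for $C'$ the alphabet is $F=\mathbb{Z}_2$ and $k=2n$. *)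

(* Defs.v *)
From mathcomp Require Import all_boot all_order all_algebra.

Set Implicit Arguments.
Unset Strict Implicit.
Unset Printing Implicit Defensive.

Import GRing.Theory.
Local Open Scope ring_scope.

Definition linear_code (n : nat) (C : {set 'rV['Z_4]_n}) : Prop :=
  GRing.submod_closed (mem C).

Definition gray (a : 'Z_4) : 'rV['Z_2]_2 :=
  \row_(j < 2)
    nth 0 (nth [::] [:: [:: 0; 0]; [:: 0; 1]; [:: 1; 1]; [:: 1; 0]] a) j.

(* mxvec lists the rows of the n x 2 matrix one after the other. *)
Definition gray_word (n : nat) (c : 'rV['Z_4]_n) : 'rV['Z_2]_(n * 2) :=
  mxvec (\matrix_(i < n) gray (c 0 i)).

Definition gray_image (n : nat) (C : {set 'rV['Z_4]_n}) :
    {set 'rV['Z_2]_(n * 2)} :=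
  [set gray_word c | c in C].

(* The chosen columns are given, in some order, by an injection f. *)
Definition orthogonal_array (F : finType) (N k : nat) (A : 'M[F]_(N, k))
    (t lambda : nat) : bool :=
  (t <= k)%N &&
  [forall f : {ffun 'I_t -> 'I_k}, injectiveb f ==>
    [forall v : 'rV[F]_t,
      #|[set i : 'I_N | row i (colsub f A) == v]| == lambda]].

Definition code_array (F : finType) (k : nat) (D : {set 'rV[F]_k}) :
    'M[F]_(#|D|, k) :=
  \matrix_(i < #|D|) enum_val i.

(* Bounding the index by the number of rows keeps the definition boolean and
   loses nothing: see oa_codeP. *)
Definition oa_code (F : finType) (k : nat) (D : {set 'rV[F]_k}) (t : nat) :
    bool :=
  [exists lambda : 'I_(#|D|.+1), orthogonal_array (code_array D) t lambda].

Definition Str (F : finType) (k : nat) (D : {set 'rV[F]_k}) : nat :=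
  \max_(t < k.+1 | oa_code D t) t.

Lemma oa_codeP (F : finType) (k : nat) (D : {set 'rV[F]_k}) (t : nat) :
  reflect (exists lambda : nat, orthogonal_array (code_array D) t lambda)
          (oa_code D t).
Proof.
apply: (iffP existsP) => [[l Hl]|[l Hl]]; first by exists (l : nat).
have [le_l|gt_l] := leqP l #|D|; first by exists (Ordinal (le_l : l < #|D|.+1)%N).
exists ord0; case/andP: Hl => le_tk /forallP Hl; apply/andP; split=> //.
apply/forallP=> f; apply/implyP=> inj_f; apply/forallP=> v.
move: (Hl f); rewrite inj_f => /forallP/(_ v)/eqP El.
have := max_card (mem [set i : 'I_#|D| | row i (colsub f (code_array D)) == v]).
by rewrite El card_ord leqNgt gt_l.
Qed.

Lemma oa_code0 (F : finType) (k : nat) (D : {set 'rV[F]_k}) : oa_code D 0.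
Proof.
apply/oa_codeP; exists #|D|; apply/andP; split=> //.
apply/forallP=> f; apply/implyP=> _; apply/forallP=> v.
rewrite -[X in _ == X]card_ord -cardsT; apply/eqP/eq_card=> i.
by rewrite !inE; apply/eqP/rowP; case.
Qed.

Lemma StrP (F : finType) (k : nat) (D : {set 'rV[F]_k}) (t : nat) :
  Str D = t <-> oa_code D t /\ (forall s, oa_code D s -> (s <= t)%N).
Proof.
have le_k s : oa_code D s -> (s < k.+1)%N.
  by case/oa_codeP=> l /andP[].
have ub s : oa_code D s -> (s <= Str D)%N.
  move=> Ds; exact: (@leq_bigmax_cond _ (fun i : 'I_k.+1 => oa_code D i)
    (fun i : 'I_k.+1 => i : nat) (Ordinal (le_k s Ds))).
have at_max : oa_code D (Str D).
  rewrite /Str; elim/big_ind: _ => // [|x y Dx Dy]; first exact: oa_code0.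
  by rewrite /maxn; case: ifP.
split=> [<- //|[Dt max_t]].
by apply/eqP; rewrite eqn_leq max_t // ub.
Qed.

Lemma gray_wordE (n : nat) (c : 'rV['Z_4]_n) (i : 'I_n) (j : 'I_2) :
  gray_word c 0 (mxvec_index i j) = gray (c 0 i) 0 j.
Proof. by rewrite mxvecE mxE. Qed.

(* Main.v *)
Require Import Defs.
From mathcomp Require Import all_boot all_order all_algebra.

(** The Gray map is a bijection from Z_4 to Z_2^2, so the words of [C] are
    equidistributed on a set [J] of coordinates if and only if the words of the
    Gray image are equidistributed on the [2 * #|J|] coordinates lying over [J].
    Any [t] binary coordinates lie over at most [t] quaternary ones, which gives
    the lower bound; strength [2 * t + 2] of the image would force strength
    [t + 1] on [C], which gives the upper one. *)

Set Implicit Arguments.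
Unset Strict Implicit.
Unset Printing Implicit Defensive.

Import GRing.Theory.
Local Open Scope ring_scope.

Definition agree (F : finType) (k : nat) (J : {set 'I_k}) (v c : 'rV[F]_k) :=
  [forall j in J, c 0 j == v 0 j].

(** The count is stated as a product, so neither an index nor a division occurs. The columns form a
    set, which removes their order, and only the entries of [v] on [J] matter. *)
Definition equidistributed (F : finType) (k : nat) (D : {set 'rV[F]_k})
    (J : {set 'I_k}) : Prop :=
  forall v : 'rV[F]_k,
    (#|[set c in D | agree J v c]| * #|F| ^ #|J|)%N = #|D|.

(** The words agreeing with [v] on [J] split by their value at [j] into [#|F|] classes, all of the
    same size by equidistribution on [j |: J]. *)
Lemma equidistributedD1 (F : finType) (k : nat) (D : {set 'rV[F]_k})
    (J : {set 'I_k}) (j : 'I_k) :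
  (0 < #|F|)%N -> j \notin J -> equidistributed D (j |: J) ->
  equidistributed D J.
Proof.
move=> F_gt0 jJ unifD v.
pose upd a : 'rV[F]_k := \row_i (if i == j then a else v 0 i).
have splitJ : #|[set c in D | agree J v c]|
    = (\sum_(a : F) #|[set c in D | agree (j |: J) (upd a) c]|)%N.
  rewrite -sum1_card (partition_big (fun c : 'rV[F]_k => c 0 j) predT) //=.
  apply: eq_bigr => a _; rewrite -sum1_card; apply: eq_bigl => c.
  rewrite !inE -andbA; congr (_ && _).
  apply/andP/forall_inP => [[/forall_inP cv /eqP cja] i|cv].
    rewrite !inE mxE; have [-> _|_ /= iJ] := eqVneq i j; first by rewrite cja.
    exact: cv.
  split; last by have := cv j (setU11 _ _); rewrite mxE eqxx.
  apply/forall_inP => i iJ; have := cv i (setU1r _ iJ).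
  by rewrite mxE (negPf (memPn jJ i iJ)).
apply/eqP; rewrite -(eqn_pmul2l F_gt0) mulnCA -expnS splitJ big_distrl /=.
rewrite (eq_bigr (fun=> #|D|)) => [|a _]; first by rewrite sum_nat_const.
by rewrite -(unifD (upd a)) cardsU1 jJ add1n.
Qed.

Lemma equidistributedS (F : finType) (k : nat) (D : {set 'rV[F]_k})
    (J K : {set 'I_k}) :
  (0 < #|F|)%N -> J \subset K -> equidistributed D K -> equidistributed D J.
Proof.
move=> F_gt0; move: {2}#|K :\: J| (erefl #|K :\: J|) => m.
elim: m J => [|m IHm] J cardKJ sJK unifK.
  suff -> : J = K by [].
  by apply/eqP; rewrite eqEsubset sJK -setD_eq0 -cards_eq0 cardKJ eqxx.
have /card_gt0P[j] : (0 < #|K :\: J|)%N by rewrite cardKJ.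
rewrite inE => /andP[jJ jK]; apply: (equidistributedD1 F_gt0 jJ).
apply: IHm unifK; last by rewrite subUset sub1set jK.
apply/eqP; rewrite -eqSS -cardKJ (cardsD1 j (K :\: J)) !inE jJ jK add1n eqSS.
by rewrite setUC setDDl.
Qed.

(** An orthogonal array is tested on exactly [t] columns. A smaller [J] is enlarged one column at a
    time; [t <= k] ensures that a new column is available. *)
Lemma equidistributed_extend (F : finType) (k t : nat) (D : {set 'rV[F]_k}) :
  (0 < #|F|)%N -> (t <= k)%N ->
  (forall K : {set 'I_k}, #|K| = t -> equidistributed D K) ->
  forall J : {set 'I_k}, (#|J| <= t)%N -> equidistributed D J.
Proof.
move=> F_gt0 le_tk unifD J le_Jt.
move: {2}(t - #|J|)%N (erefl (t - #|J|)%N) => m.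
elim: m J le_Jt => [|m IHm] J le_Jt tJ.
  by apply: unifD; apply/eqP; rewrite eqn_leq le_Jt -subn_eq0 tJ.
have lt_Jt : (#|J| < t)%N by rewrite -subn_gt0 tJ.
have /card_gt0P[j] : (0 < #|~: J|)%N.
  by rewrite cardsCs setCK card_ord subn_gt0 (leq_trans lt_Jt).
rewrite inE => jJ; apply: (equidistributedD1 F_gt0 jJ).
by apply: IHm; rewrite cardsU1 jJ add1n // subnS tJ.
Qed.

Lemma card_code_array_rows (F : finType) (k t : nat) (D : {set 'rV[F]_k})
    (f : {ffun 'I_t -> 'I_k}) (v : 'rV[F]_k) :
  #|[set i : 'I_#|D| | row i (colsub f (code_array D)) == colsub f v]|
  = #|[set c in D | agree (f @: setT) v c]|.
Proof.
rewrite -(card_imset _ enum_val_inj); apply: eq_card => c.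
rewrite !inE; have agreeE (i : 'I_#|D|) :
    (row i (colsub f (code_array D)) == colsub f v)
    = agree (f @: setT) v (enum_val i).
  apply/eqP/forall_inP => [/rowP Ei _ /imsetP[a _ ->]|Ei].
    by have := Ei a; rewrite !mxE => ->.
  by apply/rowP => a; rewrite !mxE; apply/eqP/Ei/imset_f.
apply/imsetP/andP => [[i]|[cD cv]].
  by rewrite inE agreeE => iv ->; split=> //; apply: enum_valP.
exists (enum_rank_in cD c); last by rewrite enum_rankK_in.
by rewrite inE agreeE enum_rankK_in.
Qed.

Lemma colsub_surj (F : finType) (k t : nat) (f : 'I_t -> 'I_k)
    (v : 'rV[F]_t) :
  (0 < #|F|)%N -> injective f -> exists w : 'rV[F]_k, v = colsub f w.
Proof.
move=> /card_gt0P[x _] inj_f.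
(* The filler [x] occupies the columns outside the range of [f]. *)
exists (\row_j (if [pick i | f i == j] is Some i then v 0 i else x)).
apply/rowP => i; rewrite !mxE; case: pickP => [a /eqP/inj_f -> //|/(_ i)].
by rewrite eqxx.
Qed.

(** This trades injections and an existential index for sets of columns and a fixed count. *)
Lemma oa_code_equidistributed (F : finType) (k t : nat) (D : {set 'rV[F]_k}) :
  (0 < #|F|)%N ->
  oa_code D t <->
  (t <= k)%N /\
  forall J : {set 'I_k}, (#|J| <= t)%N -> equidistributed D J.
Proof.
move=> F_gt0; split=> [/oa_codeP[l /andP[le_tk /forallP oaD]]|[le_tk unifD]].
  split=> //; apply: equidistributed_extend => // K cardK v.
  pose f := [ffun i : 'I_t => enum_val (cast_ord (esym cardK) i)].
  have inj_f : injective f.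
    by move=> i j; rewrite !ffunE => /enum_val_inj/cast_ord_inj.
  have imf : f @: setT = K.
    apply/eqP; rewrite eqEcard card_imset // cardsT card_ord cardK leqnn andbT.
    by apply/subsetP => _ /imsetP[i _ ->]; rewrite ffunE enum_valP.
  have rowsE u : #|[set i | row i (colsub f (code_array D)) == u]| = l.
    by have /implyP/(_ (introT (injectiveP f) inj_f))/forallP/(_ u)/eqP := oaD f.
  rewrite -imf -card_code_array_rows rowsE imf cardK -[RHS]card_ord -[RHS]sum1_card.
  (* Sorting the rows by the tuple they show in the columns [f] gives [#|F| ^ t] classes of size
     [l], which determines [l]. *)
  rewrite (partition_big (fun i => row i (colsub f (code_array D))) predT) //=.
  rewrite (eq_bigr (fun=> l)) => [|u _].
    by rewrite sum_nat_const card_mx mul1n mulnC.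
  by rewrite -[RHS](rowsE u) -sum1_card; apply: eq_bigl => i; rewrite inE.
(* The division is exact by equidistribution on any [t] columns. *)
apply/oa_codeP; exists (#|D| %/ #|F| ^ t)%N; apply/andP; split=> //.
apply/forallP => f; apply/implyP => /injectiveP inj_f; apply/forallP => v.
have [w ->] := colsub_surj v F_gt0 inj_f.
have cardf : #|f @: setT| = t by rewrite card_imset // cardsT card_ord.
rewrite card_code_array_rows -(unifD (f @: setT) _ w) cardf //.
by rewrite mulnK // expn_gt0 F_gt0.
Qed.

Lemma gray_bij : bijective gray.
Proof.
apply: inj_card_bij => [a b /rowP eq_ab|]; last first.
  by rewrite card_mx !card_ord.
have := eq_ab 0; have := eq_ab 1; rewrite !mxE.
case: a {eq_ab} => [[|[|[|[|?]]]] ?] //; case: b => [[|[|[|[|?]]]] ?] //;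
  by move=> /(congr1 val) /= ? /(congr1 val) /= ?; apply/val_inj.
Qed.

Lemma gray_word_bij (n : nat) : bijective (@gray_word n).
Proof.
apply: inj_card_bij => [c d /(can_inj mxvecK)/matrixP eq_cd|]; last first.
  by rewrite !card_mx !card_ord !mul1n mulnC expnM.
apply/rowP => i; apply: (bij_inj gray_bij); apply/rowP => j.
by have := eq_cd i j; rewrite !mxE.
Qed.

(** Decodes a position of [mxvec] and keeps the row: the quaternary coordinate over which [p]
    lies. *)
Definition block_of (n : nat) (p : 'I_(n * 2)) : 'I_n :=
  (enum_val (cast_ord (esym (mxvec_cast n 2)) p)).1.

Lemma block_of_index (n : nat) (i : 'I_n) (j : 'I_2) :
  block_of (mxvec_index i j) = i.
Proof. by rewrite /block_of /mxvec_index cast_ordK enum_rankK. Qed.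

Lemma card_preim_block (n : nat) (J : {set 'I_n}) :
  #|@block_of n @^-1: J| = (#|J| * 2)%N.
Proof.
have -> : (#|J| * 2)%N = #|setX J [set: 'I_2]|.
  by rewrite cardsX cardsT card_ord.
rewrite -(card_imset _ (bij_inj (onT_bij (curry_mxvec_bij n 2)))).
apply: eq_card => p; rewrite inE; case/mxvec_indexP: p => i j.
rewrite block_of_index; apply/idP/imsetP => [iJ|[[a b]]].
  by exists (i, j) => //; rewrite !inE iJ.
rewrite !inE andbT => aJ /(congr1 (@block_of n)).
by rewrite /= !block_of_index => ->.
Qed.

(** The preimage of [J] consists of whole blocks, so both bits of each symbol are compared and
    injectivity of [gray] applies. *)
Lemma agree_gray (n : nat) (J : {set 'I_n}) (v c : 'rV['Z_4]_n) :
  agree (@block_of n @^-1: J) (gray_word v) (gray_word c) = agree J v c.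
Proof.
apply/forall_inP/forall_inP => [cv i iJ|cv p].
  apply/eqP/(bij_inj gray_bij)/rowP => j; rewrite -!gray_wordE.
  by apply/eqP/cv; rewrite inE block_of_index.
rewrite inE; case/mxvec_indexP: p => i j; rewrite block_of_index => iJ.
by rewrite !gray_wordE (eqP (cv i iJ)).
Qed.

Lemma equidistributed_gray (n : nat) (C : {set 'rV['Z_4]_n}) (J : {set 'I_n}) :
  equidistributed (gray_image C) (@block_of n @^-1: J) <->
  equidistributed C J.
Proof.
have gray_inj := bij_inj (gray_word_bij n).
have countE v :
    #|[set c in gray_image C | agree (@block_of n @^-1: J) (gray_word v) c]|
    = #|[set c in C | agree J v c]|.
  rewrite -(card_imset [set c in C | agree J v c] gray_inj).
  apply: eq_card => c.
  rewrite inE; apply/andP/imsetP => [[/imsetP[d dC ->]]|[d]].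
    by rewrite agree_gray => dv; exists d; rewrite // inE dC.
  by rewrite inE => /andP[dC dv] ->; rewrite agree_gray imset_f.
have powE : (#|'Z_2| ^ #|@block_of n @^-1: J| = #|'Z_4| ^ #|J|)%N.
  by rewrite card_preim_block !card_ord mulnC expnM.
have cardE : #|gray_image C| = #|C| by rewrite card_imset.
have [ungray _ ungrayK] := gray_word_bij n.
split=> unif v; first by rewrite -countE -powE unif.
(* Surjectivity of [gray_word] makes the arbitrary binary pattern [v] a Gray word. *)
by rewrite -(ungrayK v) countE powE unif.
Qed.

Theorem corollary4p2 (n t : nat) (C : {set 'rV['Z_4]_n}) :
  (1 <= n)%N -> linear_code C -> Str C = t ->
  (t <= Str (gray_image C) <= 2 * t + 1)%N.
Proof.
have Z4_gt0 : (0 < #|'Z_4|)%N by rewrite card_ord.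
have Z2_gt0 : (0 < #|'Z_2|)%N by rewrite card_ord.
move=> _ _ /StrP[/(oa_code_equidistributed _ _ Z4_gt0)[le_tn unifC] max_t].
have /StrP[oaC' max_s] := erefl (Str (gray_image C)).
apply/andP; split.
  apply: max_s; apply/(oa_code_equidistributed _ _ Z2_gt0).
  split=> [|J le_Jt]; first by rewrite (leq_trans le_tn) // leq_pmulr.
  (* [J] is enlarged to the union of the blocks it meets; there are at most [#|J|] of them. *)
  apply: (equidistributedS (K := @block_of n @^-1: (@block_of n @: J))) => //.
    by apply/subsetP => p pJ; rewrite inE imset_f.
  apply/equidistributed_gray/unifC.
  exact: leq_trans (leq_imset_card _ _) le_Jt.
rewrite leqNgt addn1; apply/negP => gt_s.
case/(oa_code_equidistributed _ _ Z2_gt0): oaC' => le_s unifC'.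
have le_2t : (t.+1 * 2 <= Str (gray_image C))%N by rewrite mulnC mulnS.
suff /max_t : oa_code C t.+1 by rewrite ltnn.
apply/(oa_code_equidistributed _ _ Z4_gt0); split=> [|J le_Jt].
  (* The image has length [n * 2], so strength at least [t.+1 * 2] already forces [t.+1 <= n]. *)
  by rewrite -(leq_pmul2r (isT : 0 < 2)%N) (leq_trans le_2t).
apply/equidistributed_gray/unifC'; rewrite card_preim_block.
by rewrite (leq_trans _ le_2t) // leq_pmul2r.
Qed.
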